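(* Let $\check{\mathfrak A}_1$ be the set of ordered reflexive directed graphs $\mathcal G_{\ell,k}^{(p)}$ defined in the context. The profile of every member of $\check{\mathfrak A}_1$ is either given by one of the five functions $\varphi_1(n):=2^n-1$, $\varphi_2(n):=2^n-n$, $\varphi_3(n):=2^{n-1}$, $\varphi_4(n):=2^{n-1}+1$ and the Fibonacci sequence $n\mapsto F_n$, or is bounded below by one of them (equalities and inequalities being understood for all $n\geq 2$).
   Context: The profile of a structure $\mathcal R$ is the function $\varphi_{\mathcal R}$ where $\varphi_{\mathcal R}(n)$ is the number, up to isomorphism, of induced substructures of $\mathcal R$ on $n$-element subsets of its domain. $F_0=F_1=1$ and $F_n=F_{n-1}+F_{n-2}$ for $n\ge2$. The members of $\check{\mathfrak A}_1$ are ordered reflexive directed graphs $\mathcal G_{\ell,k}^{(p)}=(V,\leq,\rho)$, where $\leq$ is a linear order on $V$ and $\rho$ is a reflexive binary relation on $V$ (''edges''). Let $A=\mathbb N\times\{0\}$, $B=\mathbb N\times\{1\}$. The domain $V$ is $A\cup B$, except for $p\le 4$, $\ell\in\{1,2\}$, $13\le k\le 18$, where $V=A\cup B\cup\{a\}$ with $a\notin A\cup B$. For a set $X$ of pairs, $X^{-1}=\{(y,x):(x,y)\in X\}$. Order (depends on $\ell\in\{1,\dots,6\}$). $\ell=1$: $(0,0)<(0,1)<(1,0)<(1,1)<(2,0)<\cdots$, with $a$ below all other elements if $a\in V$. $\ell=2$: the reverse of the order for $\ell=1$. For $\ell\ge3$ all elements of $A$ precede all elements of $B$, and the order types of $A$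 and $B$ (with $(n,i)$ increasing in $n$ for $\omega$, decreasing in $n$ for $\omega^*$) are: $\ell=3$: $\omega,\omega$; $\ell=4$: $\omega^*,\omega$; $\ell=5$: $\omega,\omega^*$; $\ell=6$: $\omega^*,\omega^*$. Restriction of $\rho$ to $A$ and to $B$ (depends on $p\in\{1,\dots,10\}$). Four types are used on $\mathbb N\times\{i\}$: antichain (only loops); $\omega$-chain ($(n,i)\,\rho\,(m,i)$ iff $n\le m$); $\omega^*$-chain ($(n,i)\,\rho\,(m,i)$ iff $n\ge m$); clique (all pairs). For $p=1,2,3,4$ both $A$ and $B$ are, respectively, antichains, $\omega$-chains, $\omega^*$-chains, cliques. For $p\ge5$ there is a pair of types $(S,T)$: $p=5$: ($\omega$-chain, antichain); $p=6$: ($\omega^*$-chain, antichain); $p=7$: (clique, antichain); $p=8$: ($\omega$-chain, $\omega^*$-chain); $p=9$: ($\omega$-chain, clique); $p=10$: ($\omega^*$-chain, clique); which of $A$, $B$ has type $S$ and which has type $T$ is given below. Remaining edges. Define sets of pairs: $C_1=\{((n,0),(n,1)):n\in\mathbb N\}$, $C_2=C_1^{-1}$, $C_3=C_1\cup C_2$; $C_4=\{((n,0),(m,1)):n\le m\}$, $C_5=C_4^{-1}$, $C_6=C_4\cup C_5$; $C_7=A\times B$; $C_8=(A\times B)\cup\{((n,1),(m,0)):n<m\}$, $C_9=C_8^{-1}$; $C_{10}=C_4\cup\{((n,1),(m,0)):n<m\}$, $C_{11}=C_{10}^{-1}$, $C_{12}=(A\times B)\cup(B\times A)$; $C'_{11}=(A\times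 B)\cup\{((n,1),(m,0)):n\ge m\}$, $C'_{12}=C_{10}\cup\{((n,1),(m,0)):n\ge m\}$, $C'_{13}=\{((n,0),(m,1)):n\ne m\}\cup\{((m,1),(n,0)):n\neq m\}$, $C'_{14}=C'_{13}\cup C_1$, $C'_{15}=C'_{13}\cup C_2$; $D_{13}=\{a\}\times B$, $D_{14}=D_{13}^{-1}$, $D_{15}=D_{13}\cup D_{14}$, $D_{16}=(\{a\}\times A)\cup(B\times\{a\})$, $D_{17}=D_{16}\cup D_{13}$, $D_{18}=D_{17}^{-1}$. Besides loops and the edges inside $A$ and inside $B$, the edges of $\mathcal G_{\ell,k}^{(p)}$ are exactly the following. Case $\ell\in\{1,2\}$. $p=1$ ($1\le k\le18$): $C_k$ for $k\le12$; $D_k$ for $13\le k\le18$. $p=2$ ($1\le k\le21$): $C_k$ for $k\le9$; $C_{10}\setminus C_1$ for $k=10$; $(C_{10}\setminus C_1)\cup C_2$ for $k=11$; $C_{10}\cup C_2$ for $k=12$; $C_{10}\cup D_k$ for $13\le k\le18$; $C_{11}$ for $k=19$; $C_{12}$ for $k=20$; none for $k=21$. $p=3$ ($1\le k\le21$): $C_k$ for $k\le9$; for $10\le k\le21$, the set $X^{-1}$ where $X$ is the set given for $p=2$ and the same $k$. $p=4$ ($1\le k\le21$): $C_k$ for $k\le9$; $C_{12}\setminus C_3$ for $k=10$; $C_{12}\setminus C_2$ for $k=11$; $C_{12}\setminus C_1$ for $k=12$; $C_{12}\cup D_k$ for $13\le k\le18$; $C_{11}$ for $k=19$; $C_{10}$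 for $k=20$; none for $k=21$. $5\le p\le10$ ($1\le k\le22$): for $1\le k\le12$, $A$ has type $S$, $B$ type $T$, edges $C_k$; for $13\le k\le21$, $A$ has type $T$, $B$ type $S$, edges $C_{k-12}$; for $k=22$, $A$ has type $S$, $B$ type $T$, no other edges. Case $3\le\ell\le6$. $p=1$ ($1\le k\le15$): $C_k$ for $k\le6$; $C_{k+1}$ for $7\le k\le10$; $C'_k$ for $11\le k\le15$. $p=2$ ($1\le k\le15$): $C_k$ for $k\le6$; $C_{10}$ for $k=7$; $C_k$ for $k=8,9$; $C_{11}$ for $k=10$; $C'_k$ for $11\le k\le15$. $p=3$ ($1\le k\le15$): $C_k$ for $k\le6$; $C_{11}$ for $k=7$; $C_k$ for $k=8,9$; $C_{10}$ for $k=10$; $C'_k$ for $11\le k\le15$. $p=4$ ($1\le k\le15$): $C_k$ for $k\le6$; $C_{k+1}$ for $k=7,8$; $C_{11}$ for $k=9$; $C_{10}$ for $k=10$; $C'_k$ for $11\le k\le15$. $5\le p\le10$ ($1\le k\le24$): with $A$ of type $S$ and $B$ of type $T$: $C_k$ for $k\le6$, $C_{k+1}$ for $7\le k\le10$, $C'_{k-6}$ for $19\le k\le21$; with $A$ of type $T$ and $B$ of type $S$: $C_{k-10}$ for $11\le k\le16$, $C_{k-9}$ for $k=17,18$, $C'_{k-9}$ for $22\le k\le24$. *)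

(* Defs.v *)
From HB Require Import structures.
From mathcomp Require Import all_boot finmap.
From mathcomp Require Import zify.
From mathcomp Require Import boolp classical_sets functions cardinality.

Set Implicit Arguments.
Unset Strict Implicit.
Unset Printing Implicit Defensive.

Local Open Scope classical_set_scope.

Record ordered_digraph := OrderedDigraph {
  vertex :> choiceType;
  ord : rel vertex;
  edge : rel vertex;
  ord_anti : antisymmetric ord;
  ord_trans : transitive ord;
  ord_total : total ord;
  edge_refl : reflexive edge }.

Definition isomorphic (G H : ordered_digraph) : Prop :=
  exists f : G -> H,
    [/\ bijective f,
        forall x y : G, ord (f x) (f y) = ord x y
      & forall x y : G, edge (f x) (f y) = edge x y].

Section Restriction.
Variables (T U : Type) (h : U -> T).

Lemma relpre_anti (r : rel T) :
  injective h -> antisymmetric r -> antisymmetric (relpre h r).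
Proof. by move=> hI ra x y /ra /hI. Qed.

Lemma relpre_trans (r : rel T) : transitive r -> transitive (relpre h r).
Proof. by move=> rt y x z; apply: rt. Qed.

Lemma relpre_total (r : rel T) : total r -> total (relpre h r).
Proof. by move=> rt x y; apply: rt. Qed.

Lemma relpre_refl (r : rel T) : reflexive r -> reflexive (relpre h r).
Proof. by move=> rr x; apply: rr. Qed.

End Restriction.

Arguments relpre_anti {T U h r}.
Arguments relpre_trans {T U h r}.
Arguments relpre_total {T U h r}.
Arguments relpre_refl {T U h r}.

Definition induced (G : ordered_digraph) (X : {fset G}) : ordered_digraph :=
  @OrderedDigraph X (relpre val (@ord G)) (relpre val (@edge G))
    (relpre_anti val_inj (@ord_anti G))
    (relpre_trans (@ord_trans G))
    (relpre_total (@ord_total G))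
    (relpre_refl (@edge_refl G)).

Definition iso_class (G : ordered_digraph) (X : {fset G}) : set {fset G} :=
  [set Y | isomorphic (induced X) (induced Y)].

Definition iso_classes (G : ordered_digraph) (n : nat) : set (set {fset G}) :=
  [set iso_class X | X in [set X : {fset G} | #|` X| = n]].

Arguments iso_classes : clear implicits.

(* [fset_set] is the empty set on an infinite argument; this never happens
   here, see [finite_iso_classes] below. *)
Definition profile (G : ordered_digraph) (n : nat) : nat :=
  #|` fset_set (iso_classes G n)|.

Lemma finite_iso_classes (G : ordered_digraph) (n : nat) :
  finite_set (iso_classes G n).
Proof.
pose code := {ffun 'I_n * 'I_n -> bool * bool}.
pose cls (S : code) : set {fset G} := [set Y | exists f : induced Y -> 'I_n,
  bijective f /\ forall x y, S (f x, f y) = (ord x y, edge x y)].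
apply: (@sub_finite_set _ _ (range cls)); last exact/finite_image/finite_finset.
move=> _ [X /= Xn <-].
have cX : #|{: X}| = n by rewrite -Xn cardfE.
pose g (i : 'I_n) : induced X := enum_val (cast_ord (esym cX) i).
pose g' (x : induced X) : 'I_n := cast_ord cX (enum_rank x).
have gK : cancel g g'.
  by move=> i; rewrite /g /g' enum_valK cast_ordKV.
have g'K : cancel g' g.
  by move=> x; rewrite /g /g' cast_ordK enum_rankK.
exists [ffun p => (ord (g p.1) (g p.2), edge (g p.1) (g p.2))] => //.
apply/seteqP; split=> Y /=.
- case=> f [[f' fK f'K] fS]; exists (fun x => f' (g' x)); split.
  + by exists (fun y => g (f y)) => x; rewrite ?f'K ?g'K ?gK ?fK.
  + move=> x y; have := fS (f' (g' x)) (f' (g' y)).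
    by rewrite !f'K ffunE /= !g'K => -[-> _].
  + move=> x y; have := fS (f' (g' x)) (f' (g' y)).
    by rewrite !f'K ffunE /= !g'K => -[_ ->].
- case=> h [[h' hK h'K] hord hedge]; exists (fun y => g' (h' y)); split.
    by exists (fun i => h (g i)) => y; rewrite ?g'K ?h'K ?hK ?gK.
  move=> x y; have := hord (h' x) (h' y); have := hedge (h' x) (h' y).
  by rewrite ffunE !h'K [(_, _).1]/= [(_, _).2]/= !g'K => -> ->.
Qed.

(* The point [Some (n, false)] is (n,0) in A, the point [Some (n, true)] is
   (n,1) in B, and [None] is the additional vertex a. *)
Definition point := option (nat * bool).

Definition cup_rel (r s : rel point) : rel point := fun x y => r x y || s x y.
Definition diff_rel (r s : rel point) : rel point := fun x y => r x y && ~~ s x y.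
Definition inv_rel (r : rel point) : rel point := fun x y => r y x.

(* The set of all ((n,0),(m,1)) with [r n m]. *)
Definition AtoB (r : rel nat) : rel point := fun x y =>
  match x, y with Some (n, false), Some (m, true) => r n m | _, _ => false end.

(* The set of all ((n,1),(m,0)) with [r n m]. *)
Definition BtoA (r : rel nat) : rel point := fun x y =>
  match x, y with Some (n, true), Some (m, false) => r n m | _, _ => false end.

Definition C1 := AtoB (fun n m => n == m).
Definition C2 := inv_rel C1.
Definition C3 := cup_rel C1 C2.
Definition C4 := AtoB (fun n m => n <= m).
Definition C5 := inv_rel C4.
Definition C6 := cup_rel C4 C5.
Definition C7 := AtoB (fun _ _ => true).
Definition C8 := cup_rel C7 (BtoA (fun n m => n < m)).
Definition C9 := inv_rel C8.
Definition C10 := cup_rel C4 (BtoA (fun n m => n < m)).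
Definition C11 := inv_rel C10.
Definition C12 := cup_rel C7 (BtoA (fun _ _ => true)).

Definition C (k : nat) : rel point :=
  match k with
  | 1 => C1 | 2 => C2 | 3 => C3 | 4 => C4 | 5 => C5 | 6 => C6
  | 7 => C7 | 8 => C8 | 9 => C9 | 10 => C10 | 11 => C11 | 12 => C12
  | _ => fun _ _ => false
  end.

Definition C'11 := cup_rel C7 (BtoA (fun n m => n >= m)).
Definition C'12 := cup_rel C10 (BtoA (fun n m => n >= m)).
Definition C'13 := cup_rel (AtoB (fun n m => n != m)) (BtoA (fun m n => n != m)).
Definition C'14 := cup_rel C'13 C1.
Definition C'15 := cup_rel C'13 C2.

Definition C' (k : nat) : rel point :=
  match k with
  | 11 => C'11 | 12 => C'12 | 13 => C'13 | 14 => C'14 | 15 => C'15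
  | _ => fun _ _ => false
  end.

Definition atoA : rel point := fun x y =>
  match x, y with None, Some (_, false) => true | _, _ => false end.
Definition atoB : rel point := fun x y =>
  match x, y with None, Some (_, true) => true | _, _ => false end.

Definition D13 := atoB.
Definition D14 := inv_rel D13.
Definition D15 := cup_rel D13 D14.
Definition D16 := cup_rel atoA (inv_rel atoB).
Definition D17 := cup_rel D16 D13.
Definition D18 := inv_rel D17.

Definition D (k : nat) : rel point :=
  match k with
  | 13 => D13 | 14 => D14 | 15 => D15 | 16 => D16 | 17 => D17 | 18 => D18
  | _ => fun _ _ => false
  end.

Variant block_type := Antichain | OmegaChain | OmegaStarChain | Clique.

Definition block_rel (t : block_type) : rel nat :=
  match t with
  | Antichain => fun n m => n == m
  | OmegaChain => fun n m => n <= m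
  | OmegaStarChain => fun n m => n >= m
  | Clique => fun _ _ => true
  end.

(* The pair (S,T); for p <= 4 both components are the common type. *)
Definition type_pair (p : nat) : block_type * block_type :=
  match p with
  | 1 => (Antichain, Antichain)
  | 2 => (OmegaChain, OmegaChain)
  | 3 => (OmegaStarChain, OmegaStarChain)
  | 4 => (Clique, Clique)
  | 5 => (OmegaChain, Antichain)
  | 6 => (OmegaStarChain, Antichain)
  | 7 => (Clique, Antichain)
  | 8 => (OmegaChain, OmegaStarChain)
  | 9 => (OmegaChain, Clique)
  | _ => (OmegaStarChain, Clique)
  end.

(* Whether A has type T and B has type S (relevant for p >= 5). *)
Definition types_swapped (l k p : nat) : bool :=
  (4 < p) && if l <= 2 then 13 <= k <= 21
             else (11 <= k <= 18) || (22 <= k <= 24).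

Definition types_AB (l k p : nat) : block_type * block_type :=
  let: (s, t) := type_pair p in if types_swapped l k p then (t, s) else (s, t).

Definition inner_edges (l k p : nat) : rel point := fun x y =>
  let: (tA, tB) := types_AB l k p in
  match x, y with
  | Some (n, false), Some (m, false) => block_rel tA n m
  | Some (n, true), Some (m, true) => block_rel tB n m
  | _, _ => false
  end.

Definition cross_low_p2 (k : nat) : rel point :=
  if k <= 9 then C k
  else if k <= 12 then
    match k with
    | 10 => diff_rel C10 C1
    | 11 => cup_rel (diff_rel C10 C1) C2
    | _ => cup_rel C10 C2
    end
  else if k <= 18 then cup_rel C10 (D k)
  else match k with 19 => C11 | 20 => C12 | _ => fun _ _ => false end.

Definition cross_low_p4 (k : nat) : rel point :=
  if k <= 9 then C k
  else if k <= 12 then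
    match k with
    | 10 => diff_rel C12 C3
    | 11 => diff_rel C12 C2
    | _ => diff_rel C12 C1
    end
  else if k <= 18 then cup_rel C12 (D k)
  else match k with 19 => C11 | 20 => C10 | _ => fun _ _ => false end.

(* Remaining edges for l = 1, 2. *)
Definition cross_low (k p : nat) : rel point :=
  match p with
  | 1 => if k <= 12 then C k else D k
  | 2 => cross_low_p2 k
  | 3 => if k <= 9 then C k else inv_rel (cross_low_p2 k)
  | 4 => cross_low_p4 k
  | _ => if k <= 12 then C k
         else if k <= 21 then C (k - 12) else fun _ _ => false
  end.

(* Remaining edges for l = 3, 4, 5, 6. *)
Definition cross_high (k p : nat) : rel point :=
  if p <= 4 then
    if k <= 6 then C k
    else if k <= 10 then
      match p, k with
      | 1, _ => C k.+1
      | 2, 7 => C10 | 2, 10 => C11 | 2, _ => C k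
      | 3, 7 => C11 | 3, 10 => C10 | 3, _ => C k
      | _, 9 => C11 | _, 10 => C10 | _, _ => C k.+1
      end
    else C' k
  else
    if k <= 6 then C k
    else if k <= 10 then C k.+1
    else if k <= 16 then C (k - 10)
    else if k <= 18 then C (k - 9)
    else if k <= 21 then C' (k - 6)
    else C' (k - 9).

Definition cross_edges (l k p : nat) : rel point :=
  if l <= 2 then cross_low k p else cross_high k p.

Definition calG_edge (l k p : nat) : rel point := fun x y =>
  [|| x == y, inner_edges l k p x y | cross_edges l k p x y].

(* Position in a < (0,0) < (0,1) < (1,0) < (1,1) < ... *)
Definition rank (x : point) : nat :=
  if x is Some (n, i) then (n.*2 + i).+1 else 0.

(* A before B, with A ordered by [rA] and B by [rB]; the value at a is
   irrelevant, as a is a vertex only when l <= 2. *)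
Definition sum_ord (rA rB : rel nat) : rel point := fun x y =>
  match x, y with
  | None, _ => true
  | Some _, None => false
  | Some (n, false), Some (m, false) => rA n m
  | Some (n, true), Some (m, true) => rB n m
  | Some (_, i), Some (_, _) => ~~ i
  end.

Definition calG_ord (l : nat) : rel point :=
  match l with
  | 1 => fun x y => rank x <= rank y
  | 2 => fun x y => rank y <= rank x
  | 3 => sum_ord (fun n m => n <= m) (fun n m => n <= m)
  | 4 => sum_ord (fun n m => n >= m) (fun n m => n <= m)
  | 5 => sum_ord (fun n m => n <= m) (fun n m => n >= m)
  | _ => sum_ord (fun n m => n >= m) (fun n m => n >= m)
  end.

Lemma rank_inj : injective rank.
Proof.
move=> [[n i]|] [[m j]|] //= [E].
have ij : i = j by have /(congr1 odd) := E; rewrite !oddD !odd_double !oddb.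
by rewrite ij in E *; have -> : n = m by lia.
Qed.

Lemma calG_ord_anti l : antisymmetric (calG_ord l).
Proof.
move: l => [|[|[|[|[|[|l]]]]]] x y /=;
  try (by move=> ?; apply: rank_inj; lia);
  by case: x y => [[n [] ]|] [[m [] ]|] //= ?; congr (Some (_, _)); lia.
Qed.

Lemma calG_ord_trans l : transitive (calG_ord l).
Proof.
move: l => [|[|[|[|[|[|l]]]]]] y x z /=; try lia;
  by case: x y z => [[n [] ]|] [[m [] ]|] [[q [] ]|] //=; lia.
Qed.

Lemma calG_ord_total l : total (calG_ord l).
Proof.
move: l => [|[|[|[|[|[|l]]]]]] x y /=; try lia;
  by case: x y => [[n [] ]|] [[m [] ]|] //=; lia.
Qed.

Lemma calG_edge_refl l k p : reflexive (calG_edge l k p).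
Proof. by move=> x; rewrite /calG_edge eqxx. Qed.

Definition has_a (l k p : nat) : bool :=
  [&& p <= 4, l <= 2 & 13 <= k <= 18].

Definition calG_vertex (l k p : nat) : choiceType :=
  {x : point | isSome x || has_a l k p}.

Definition calG (l k p : nat) : ordered_digraph :=
  @OrderedDigraph (calG_vertex l k p)
    (relpre val (calG_ord l)) (relpre val (calG_edge l k p))
    (relpre_anti val_inj (@calG_ord_anti l))
    (relpre_trans (@calG_ord_trans l))
    (relpre_total (@calG_ord_total l))
    (relpre_refl (@calG_edge_refl l k p)).

(* The largest index k for the given l and p. *)
Definition max_k (l p : nat) : nat :=
  if l <= 2 then (if p == 1 then 18 else if p <= 4 then 21 else 22)
  else (if p <= 4 then 15 else 24).

Definition frakA1 (G : ordered_digraph) : Prop :=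
  exists l k p,
    [/\ 1 <= l <= 6, 1 <= p <= 10, 1 <= k <= max_k l p & G = calG l k p].

(* F_0 = F_1 = 1. *)
Fixpoint Fib (n : nat) : nat :=
  match n with
  | 0 => 1
  | n'.+1 => if n' is n''.+1 then Fib n' + Fib n'' else 1
  end.

Definition phi1 (n : nat) : nat := 2 ^ n - 1.
Definition phi2 (n : nat) : nat := 2 ^ n - n.
Definition phi3 (n : nat) : nat := 2 ^ (n - 1).
Definition phi4 (n : nat) : nat := 2 ^ (n - 1) + 1.

Definition five_profiles : set (nat -> nat) :=
  [set phi1; phi2; phi3; phi4; Fib].

(* Main.v *)
From mathcomp Require Import all_boot finmap zify.
From mathcomp Require Import boolp classical_sets cardinality.
Require Import Defs.

(** The Fibonacci sequence is the smallest of the five functions, and it bounds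
    the profile of every member from below; this settles all members at once.

    Since the vertices are linearly ordered, an isomorphism between finite
    induced substructures is the only order isomorphism between them
    ([total_order_rigid]).  If a family of embeddings of a finite set J induces
    one and the same order on J, two members of the family therefore have
    isomorphic images only if they induce the same edges on J, and a family
    that induces pairwise distinct edge relations bounds the profile at the
    size of J by its own size ([size_le_profile]).  It remains to find, in
    each member and for each n, such a family with at least F_n elements.
    Apart from the vertex a, the edges between two vertices depend only on
    their sides A or B and on how their columns (first coordinates) compare
    ([columnwise]), so a few edge types describe a whole member.

    If A and B are interleaved (l = 1, 2), list the vertices in increasing
    order and take one of two kinds of families.  Either an extreme vertex is
    joined in different ways to A and to B; keeping it fixed, the sides of the
    other vertices can be chosen freely.  Or (n,0) and (n,1) are
    joined differently from vertices of different columns; then one chooses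
    which consecutive vertices share a column.  These consecutive pairs must be
    disjoint, which makes F_n choices, encoded by boolean words without two
    consecutive true letters.  Such words index the families of both kinds.

    If A precedes B (l >= 3), fix the number r of vertices taken in A and the
    number s taken in B.  The order on the chosen vertices is then fixed, and
    what varies is how the columns of the A-vertices compare with those of the
    B-vertices: a staircase in an r by s rectangle.  In each member the three
    possible comparisons do not all yield the same edges, and this suffices to
    realize all 'C(r + s, r) staircases by distinct edge relations
    ([columnA_split]).  For r = n./2 this number is at least F_n.

    Which family works for which (l, k, p) is decided by evaluating
    edges between the first two columns ([check_all]). *)

Set Implicit Arguments.
Unset Strict Implicit.
Unset Printing Implicit Defensive.

(** * Families of induced substructures *)

(** An automorphism preserves the number of elements below a point, and in a
    finite total order this number determines the point. *)
Lemma total_order_rigid (J : finType) (r : rel J) (g : J -> J) :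
  antisymmetric r -> transitive r -> total r ->
  (forall a b, r (g a) (g b) = r a b) -> g =1 id.
Proof.
move=> r_anti r_trans r_total gr a.
have r_refl b : r b b by have := r_total b b; rewrite orbb.
have g_inj : injective g.
  by move=> b c gbc; apply: r_anti; rewrite -(gr b) -(gr c) gbc r_refl.
pose below b := [set c | r c b].
have below_g b : g @: below b = below (g b).
  apply/setP=> c; rewrite inE; apply/imsetP/idP => [[d]|rcg].
    by rewrite inE => rdb ->; rewrite gr.
  have /codomP[d def_c] : c \in codom g by apply: inj_card_onto.
  by exists d => //; rewrite inE -gr -def_c.
have below_card b : #|below (g b)| = #|below b|.
  by rewrite -below_g card_imset.
have below_sub b c : r b c -> below b \subset below c.
  by move=> rbc; apply/fintype.subsetP => d; rewrite !inE => rdb; apply: r_trans rbc.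
have below_eq b c : r b c -> #|below b| = #|below c| -> b = c.
  move=> rbc card_eq; have /eqP E : below b == below c.
    by rewrite eqEcard below_sub //= card_eq.
  have : c \in below c by rewrite inE.
  by rewrite -E inE => rcb; apply: r_anti; rewrite rbc.
case/orP: (r_total (g a) a) => rga; first exact: below_eq.
by apply/esym/below_eq.
Qed.

(** An isomorphism from the image of [x u] to that of [x t] becomes a map g of J
    into itself; both images carry the same order, so g is the identity
    and the induced edges agree. *)
Lemma size_le_profile (G : ordered_digraph) (T : eqType) (s : seq T)
    (J : finType) (x : T -> J -> G) :
  uniq s ->
  {in s, forall t, injective (x t)} ->
  {in s &, forall t u, forall a b, ord (x t a) (x t b) = ord (x u a) (x u b)} ->
  {in s &, forall t u, t != u ->
     exists a b, edge (x t a) (x t b) != edge (x u a) (x u b)} ->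
  size s <= profile G #|J|.
Proof.
move=> s_uniq x_inj x_ord x_edge.
pose X t : {fset G} := [fset x t a | a in J]%fset.
pose cls t := iso_class (X t).
have cls_inj : {in s &, injective cls}.
  move=> t u ts us cls_eq; apply/eqP/negPn/negP => tu.
  have [f [f_bij f_ord f_edge]] : isomorphic (induced (X u)) (induced (X t)).
    have : cls t (X t).
      by exists id; split=> //; exists id.
    by rewrite cls_eq.
  have inX v a : x v a \in X v by apply: in_imfset.
  have ex_g a : exists b, val (f [` inX u a]%fset) = x t b.
    by have /imfsetP[b _ ->] := valP (f [` inX u a]%fset); exists b.
  have {ex_g} [g gE] := choice ex_g.
  have g_ord a b : ord (x t (g a)) (x t (g b)) = ord (x u a) (x u b).
    by rewrite -!gE -[LHS]/(ord (f _) (f _)) f_ord.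
  have g_edge a b : edge (x t (g a)) (x t (g b)) = edge (x u a) (x u b).
    by rewrite -!gE -[LHS]/(edge (f _) (f _)) f_edge.
  have g_id : g =1 id.
    apply: (@total_order_rigid _ (relpre (x t) (@ord G))).
    - exact/(relpre_anti (x_inj t ts))/ord_anti.
    - exact/relpre_trans/ord_trans.
    - exact/relpre_total/ord_total.
    - by move=> a b; rewrite /= g_ord (x_ord u t).
  have [a [b]] := x_edge t u ts us tu.
  by rewrite -g_edge !g_id eqxx.
rewrite /profile -(size_map cls); apply: uniq_leq_size.
  by rewrite map_inj_in_uniq.
move=> _ /mapP[t ts ->]; rewrite in_fset_set ?inE; last exact: finite_iso_classes.
exists (X t) => //=; rewrite card_imfset; last exact: x_inj.
by rewrite /= cardE.
Qed.

(** * Sparse words *)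

(** The recursion is that of the Fibonacci numbers: after a letter true, the
    next letter is forced to be false. *)
Fixpoint sparse_words (m : nat) : seq (seq bool) :=
  match m with
  | 0 => [:: [::]]
  | m'.+1 =>
    if m' is m''.+1 then
      [seq false :: w | w <- sparse_words m'] ++
      [seq [:: true, false & w] | w <- sparse_words m'']
    else [:: [:: false]; [:: true]]
  end.

Definition sparse (w : seq bool) := sorted (fun a b => ~~ (a && b)) w.

Lemma sparse_wordsP m w :
  w \in sparse_words m -> size w = m /\ sparse w.
Proof.
rewrite /sparse; elim/ltn_ind: m w => -[|[|m]] IH w.
- by rewrite inE => /eqP ->.
- by rewrite !inE => /orP[] /eqP ->.
- rewrite [sparse_words _]/= mem_cat => /orP[] /mapP[v vs ->].
    have [//|/= -> v_sp] := IH m.+1 _ v vs; split=> //.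
    by case: (v) v_sp.
  have [|/= -> v_sp] := IH m _ v vs; first lia.
  by split=> //; case: (v) v_sp.
Qed.

Lemma size_sparse_words m : size (sparse_words m) = Fib m.+1.
Proof.
elim/ltn_ind: m => -[|[|m]] IH //.
rewrite [sparse_words _]/= size_cat !size_map.
by rewrite (IH m.+1) // (IH m) // ltnW.
Qed.

Lemma sparse_words_uniq m : uniq (sparse_words m).
Proof.
elim/ltn_ind: m => -[|[|m]] IH //.
rewrite [sparse_words _]/= cat_uniq !map_inj_uniq => [|u v [//]|u v [//]].
rewrite (IH m.+1) // (IH m) ?andbT /=; last exact: ltnW.
by apply/hasPn => _ /mapP[v _ ->]; apply/mapP => -[].
Qed.

(** * Dependence of the edges on the columns *)

(** That n and m compare as n' and m' do is expressed by [<=] alone, since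
    [ltnNge] and [eqn_leq] reduce the other comparisons to it. *)
Definition columnwise (r : rel point) :=
  [/\ forall i j n m n' m', (n <= m) = (n' <= m') -> (m <= n) = (m' <= n') ->
        r (Some (n, i)) (Some (m, j)) = r (Some (n', i)) (Some (m', j)),
      forall i n n', r None (Some (n, i)) = r None (Some (n', i))
    & forall i n n', r (Some (n, i)) None = r (Some (n', i)) None].

Lemma columnwise_cup r s :
  columnwise r -> columnwise s -> columnwise (cup_rel r s).
Proof.
move=> [r1 r2 r3] [s1 s2 s3]; rewrite /cup_rel.
split=> [i j n m n' m' le_nm le_mn|i n n'|i n n'].
- by rewrite (r1 _ _ _ _ n' m') // (s1 _ _ _ _ n' m').
- by rewrite (r2 _ _ n') (s2 _ _ n').
- by rewrite (r3 _ _ n') (s3 _ _ n').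
Qed.

Lemma columnwise_diff r s :
  columnwise r -> columnwise s -> columnwise (diff_rel r s).
Proof.
move=> [r1 r2 r3] [s1 s2 s3]; rewrite /diff_rel.
split=> [i j n m n' m' le_nm le_mn|i n n'|i n n'].
- by rewrite (r1 _ _ _ _ n' m') // (s1 _ _ _ _ n' m').
- by rewrite (r2 _ _ n') (s2 _ _ n').
- by rewrite (r3 _ _ n') (s3 _ _ n').
Qed.

Lemma columnwise_inv r : columnwise r -> columnwise (inv_rel r).
Proof.
by move=> [r1 r2 r3]; split=> *; [apply: r1|apply: r3|apply: r2].
Qed.

Lemma columnwise_empty : columnwise (fun _ _ => false).
Proof. by []. Qed.

Lemma columnwise_AtoB (r : rel nat) :
  (forall n m n' m', (n <= m) = (n' <= m') -> (m <= n) = (m' <= n') ->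
     r n m = r n' m') ->
  columnwise (AtoB r).
Proof. by move=> rP; split=> [[] [] *|[]|[]] //=; apply: rP. Qed.

Lemma columnwise_BtoA (r : rel nat) :
  (forall n m n' m', (n <= m) = (n' <= m') -> (m <= n) = (m' <= n') ->
     r n m = r n' m') ->
  columnwise (BtoA r).
Proof. by move=> rP; split=> [[] [] *|[]|[]] //=; apply: rP. Qed.

(* The goals are matched syntactically: up to conversion every relation is
   the inverse of another one. *)
Ltac columnwise_step :=
  lazymatch goal with
  | |- columnwise (cup_rel _ _) => apply: columnwise_cup
  | |- columnwise (diff_rel _ _) => apply: columnwise_diff
  | |- columnwise (inv_rel _) => apply: columnwise_inv
  | |- columnwise (AtoB _) => apply: columnwise_AtoB
  | |- columnwise (BtoA _) => apply: columnwise_BtoA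
  | |- columnwise (fun _ _ => false) => exact: columnwise_empty
  end.

Ltac columnwise_unfold :=
  repeat first [columnwise_step | match goal with |- columnwise ?r => rewrite /r end].

Lemma columnwise_C k : columnwise (C k).
Proof.
do 13?[case: k => [|k]]; rewrite /C; columnwise_unfold;
  by move=> n m n' m' le_nm le_mn; rewrite ?ltnNge ?eqn_leq ?le_nm ?le_mn.
Qed.

Lemma columnwise_C' k : columnwise (C' k).
Proof.
do 16?[case: k => [|k]]; rewrite /C'; columnwise_unfold;
  by move=> n m n' m' le_nm le_mn; rewrite ?ltnNge ?eqn_leq ?le_nm ?le_mn.
Qed.

Lemma columnwise_D k : columnwise (D k).
Proof. by do 19?[case: k => [|k]]; split=> // [[]]. Qed.

Lemma columnwise_inner l k p : columnwise (inner_edges l k p).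
Proof.
rewrite /inner_edges; case: (types_AB l k p) => tA tB.
split=> [[] []||] //= n m n' m' le_nm le_mn.
  by case: tB => //=; rewrite ?eqn_leq ?le_nm ?le_mn.
by case: tA => //=; rewrite ?eqn_leq ?le_nm ?le_mn.
Qed.

Lemma columnwise_cross l k p : columnwise (cross_edges l k p).
Proof.
rewrite /cross_edges /cross_low /cross_high /cross_low_p2 /cross_low_p4.
repeat match goal with
| |- context [match ?x with _ => _ end] => destruct x end.
all: repeat first
  [ columnwise_step
  | lazymatch goal with
    | |- columnwise (C _) => exact: columnwise_C
    | |- columnwise (C' _) => exact: columnwise_C'
    | |- columnwise (D _) => exact: columnwise_D
    | |- columnwise C1 => exact: (columnwise_C 1)
    | |- columnwise C2 => exact: (columnwise_C 2)
    | |- columnwise C3 => exact: (columnwise_C 3)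
    | |- columnwise C10 => exact: (columnwise_C 10)
    | |- columnwise C11 => exact: (columnwise_C 11)
    | |- columnwise C12 => exact: (columnwise_C 12)
    end ].
Qed.

Lemma columnwise_edge l k p : columnwise (calG_edge l k p).
Proof.
have [i1 i2 i3] := columnwise_inner l k p.
have [c1 c2 c3] := columnwise_cross l k p.
rewrite /calG_edge.
split=> [i j n m n' m' le_nm le_mn|i n n'|i n n'].
- rewrite (i1 _ _ _ _ n' m') // (c1 _ _ _ _ n' m') //; congr (_ || _).
  have eq_point a b :
      (Some (a, i) == Some (b, j) :> point) = (a <= b <= a) && (i == j).
    by rewrite -eqn_leq.
  by rewrite !eq_point le_nm le_mn.
- by rewrite (i2 _ _ n') (c2 _ _ n').
- by rewrite (i3 _ _ n') (c3 _ _ n').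
Qed.

Definition pair_type (l k p : nat) (x y : point) :=
  (calG_edge l k p x y, calG_edge l k p y x).

Lemma pair_type_columns l k p n m n' m' i j :
  (n <= m) = (n' <= m') -> (m <= n) = (m' <= n') ->
  pair_type l k p (Some (n, i)) (Some (m, j)) =
  pair_type l k p (Some (n', i)) (Some (m', j)).
Proof.
move=> le_nm le_mn; have [edge_col _ _] := columnwise_edge l k p.
by congr (_, _); apply: edge_col.
Qed.

Lemma pair_type_None l k p n n' i :
  pair_type l k p None (Some (n, i)) = pair_type l k p None (Some (n', i)).
Proof.
have [_ edge_a a_edge] := columnwise_edge l k p.
by congr (_, _); [apply: edge_a | apply: a_edge].
Qed.

(** [size_le_profile] with families given at the level of points, so that the
    membership proofs of vertices need not appear in the constructions. *)
Lemma size_le_profile_calG l k p (T : eqType) (s : seq T) (J : finType)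
    (x : T -> J -> point) :
  uniq s ->
  {in s, forall t a, x t a || has_a l k p} ->
  {in s, forall t, injective (x t)} ->
  {in s &, forall t u, forall a b,
     calG_ord l (x t a) (x t b) = calG_ord l (x u a) (x u b)} ->
  {in s &, forall t u, t != u -> exists a b,
     pair_type l k p (x t a) (x t b) != pair_type l k p (x u a) (x u b)} ->
  size s <= profile (calG l k p) #|J|.
Proof.
move=> s_uniq x_vertex x_inj x_ord x_edge.
have v0P : isSome (Some (0, false) : point) || has_a l k p by [].
pose v0 : calG_vertex l k p := Sub (Some (0, false)) v0P.
pose y t a : calG l k p := insubd v0 (x t a).
have yE t a : t \in s -> val (y t a) = x t a.
  by move=> ts; rewrite insubdK //; apply: x_vertex.
apply: (@size_le_profile _ _ _ _ y) => //.
- by move=> t ts a b /(congr1 val); rewrite !yE // => /x_inj ->.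
- by move=> t u ts us a b /=; rewrite !yE //; apply: x_ord.
- move=> t u ts us tu; have [a [b ab]] := x_edge t u ts us tu.
  have [/eqP E|E] := eqVneq (edge (y t a) (y t b)) (edge (y u a) (y u b)).
    exists b, a; apply: contraNneq ab => /=; move/eqP: E => /=.
    by rewrite /pair_type !yE // => -> ->.
  by exists a, b.
Qed.

(** * Interleaved orders *)

(** As the order is given by [rank] or by its reverse, any two lists with
    increasing ranks induce the same order on their indices. *)
Lemma Fib_le_profile_increasing l k p m (x : seq bool -> nat -> point) :
  1 <= l <= 2 ->
  (forall w a, x w a || has_a l k p) ->
  (forall w a b, size w = m -> sparse w -> a < b <= m ->
     rank (x w a) < rank (x w b)) ->
  (forall w u i, size w = m -> sparse w -> size u = m -> sparse u ->
     i < m -> nth false w i -> ~~ nth false u i ->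
     exists a b, [/\ a <= m, b <= m &
       pair_type l k p (x w a) (x w b) != pair_type l k p (x u a) (x u b)]) ->
  Fib m.+1 <= profile (calG l k p) m.+1.
Proof.
move=> l12 x_vertex x_rank x_edge.
have rank_le w a b : size w = m -> sparse w -> a <= m -> b <= m ->
    (rank (x w a) <= rank (x w b)) = (a <= b).
  move=> w_size w_sp am bm; case: (ltngtP a b) => [ab|ba|->]; last exact: leqnn.
    by have := x_rank w a b w_size w_sp; lia.
  by have := x_rank w b a w_size w_sp; lia.
rewrite -size_sparse_words -[X in profile _ X]card_ord.
apply: (@size_le_profile_calG _ _ _ _ _ _ (fun w (a : 'I_m.+1) => x w a)).
- exact: sparse_words_uniq.
- by move=> w _ a; apply: x_vertex.
- move=> w /sparse_wordsP[w_size w_sp] a b xab; apply/val_inj/eqP.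
  have am := leq_ord a; have bm := leq_ord b.
  by rewrite eqn_leq -(rank_le w a b) // -(rank_le w b a) // xab leqnn.
- move=> w u /sparse_wordsP[w_size w_sp] /sparse_wordsP[u_size u_sp] a b.
  have am := leq_ord a; have bm := leq_ord b.
  have [->|->] : l = 1 \/ l = 2 by lia.
    by rewrite /= !rank_le.
  by rewrite /= !rank_le.
- move=> w u /sparse_wordsP[w_size w_sp] /sparse_wordsP[u_size u_sp] wu.
  have [i im wui] : exists2 i, i < m & nth false w i != nth false u i.
    apply: contrapT => no_i; case/eqP: wu.
    apply: (@eq_from_nth _ false) => [|i]; rewrite w_size ?u_size // => im.
    by apply/eqP/negPn/negP => wui; apply: no_i; exists i.
  have [a [b [am bm ab]]] : exists a b, [/\ a <= m, b <= m &
      pair_type l k p (x w a) (x w b) != pair_type l k p (x u a) (x u b)].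
    case wi: (nth false w i) wui; case ui: (nth false u i) => // _.
      by apply: (x_edge w u i); rewrite ?wi ?ui.
    have [|a [b [am bm ab]]] := x_edge u w i u_size u_sp w_size w_sp im ui.
      by rewrite wi.
    by exists a, b; rewrite eq_sym.
  by exists (inord a), (inord b); rewrite !inordK.
Qed.

(** The word w gives the sides of the vertices after x0.  Their columns start
    at 1; the bound on its rank says that x0 is a or lies in column 0. *)
Lemma Fib_le_profile_first l k p m (x0 : point) :
  1 <= l <= 2 -> x0 || has_a l k p -> rank x0 <= 2 ->
  pair_type l k p x0 (Some (1, false)) != pair_type l k p x0 (Some (1, true)) ->
  Fib m.+1 <= profile (calG l k p) m.+1.
Proof.
move=> l12 x0_vertex x0_rank x0_split.
pose x w a : point := if a is i.+1 then Some (a, nth false w i) else x0.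
have x0_type n i : pair_type l k p x0 (Some (n.+1, i)) =
    pair_type l k p x0 (Some (1, i)).
  case: x0 x0_rank {x0_vertex x0_split x} => [[c j]|] x0_rank.
    by apply: pair_type_columns; move: x0_rank => /=; lia.
  exact: pair_type_None.
apply: (@Fib_le_profile_increasing _ _ _ _ x) => //.
- by move=> w [|a].
- by move=> w [|a] [|b] //= *; move: x0_rank; case: (nth _ _ _); lia.
- move=> w u i _ _ _ _ im wi ui; exists 0, i.+1; split=> //=.
  by rewrite wi (negPf ui) !x0_type eq_sym.
Qed.

(** The mirror image of the previous family.  It is needed when later vertices
    on the two sides look alike from any earlier vertex, as for an omega-chain A
    and an antichain B with edges from each vertex of A to the later ones
    of B. *)
Lemma Fib_le_profile_last l k p m (c : bool) :
  1 <= l <= 2 ->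
  pair_type l k p (Some (0, false)) (Some (1, c)) !=
    pair_type l k p (Some (0, true)) (Some (1, c)) ->
  Fib m.+1 <= profile (calG l k p) m.+1.
Proof.
move=> l12 c_split.
(* A word has length m, so the default value c is the side of vertex m. *)
apply: (@Fib_le_profile_increasing _ _ _ _
  (fun w a => Some (a, nth c w a) : point)) => //.
- by move=> w a b _ _ ab /=; case: (nth _ _ _); case: (nth _ _ _); lia.
- move=> w u i w_size _ u_size _ im wi ui; exists i, m; split=> //; first exact: ltnW.
  rewrite (nth_default _ (_ : size w <= m)) ?w_size //.
  rewrite (nth_default _ (_ : size u <= m)) ?u_size //.
  rewrite (set_nth_default false) ?w_size // (set_nth_default false c) ?u_size //.
  rewrite wi (negPf ui) eq_sym !(@pair_type_columns _ _ _ i m 0 1) //; lia.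
Qed.

(** All vertices lie in A, except that letter i of the word puts vertex i.+1
    into column i of B, next to vertex i.  Sparsity keeps vertex i itself
    in A, so that the two do share a column. *)
Lemma Fib_le_profile_glued l k p m :
  1 <= l <= 2 ->
  (forall i, pair_type l k p (Some (0, false)) (Some (0, true)) !=
    pair_type l k p (Some (0, i)) (Some (1, false))) ->
  Fib m.+1 <= profile (calG l k p) m.+1.
Proof.
move=> l12 split_col.
pose x w a : point :=
  if a is i.+1 then if nth false w i then Some (i, true) else Some (a, false)
  else Some (0, false).
have sparseP w i : size w = m -> sparse w -> i.+1 < m ->
    nth false w i.+1 -> ~~ nth false w i.
  move=> w_size /(sortedP false) w_sp im wi.
  by have := w_sp i; rewrite w_size im wi andbT; apply.
apply: (@Fib_le_profile_increasing _ _ _ _ x) => //.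
- by move=> w [|a] //=; case: ifP.
- move=> w a b w_size w_sp; case: b => [|b] ab; first lia.
  case: a ab => [|a] ab /=; first by case: ifP => _ /=; lia.
  by case: ifP => _; case: ifP => _ /=; lia.
- move=> w u i w_size w_sp u_size u_sp im wi ui; exists i, i.+1.
  split; [exact: ltnW|by []|].
  have -> : x w i = Some (i, false).
    by case: i im wi {ui} => [|i] im wi //=; rewrite (negPf (sparseP w i _ _ _ _)).
  have [n [c [-> ni]]] : exists n c, x u i = Some (n, c) /\ n <= i.
    case: i {im wi ui} => [|i] /=; first by exists 0, false.
    by case: ifP => _; [exists i, true|exists i.+1, false].
  rewrite /= wi (negPf ui) (@pair_type_columns _ _ _ i i 0 0) ?leqnn //.
  rewrite (@pair_type_columns _ _ _ n i.+1 0 1) ?split_col //; lia.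
Qed.

(** * Orders in which A precedes B *)

Lemma Fib_le_central_binomial n : Fib n <= 'C(n, n./2).
Proof.
have FibSS j : Fib j.+2 = Fib j.+1 + Fib j by [].
have main j : Fib j.*2 <= 'C(j.*2, j) /\ Fib j.*2.+1 <= 'C(j.*2.+1, j).
  elim: j => [|j [IH0 IH1]]; first by [].
  have even_le : Fib j.+1.*2 <= 'C(j.+1.*2, j.+1).
    rewrite doubleS FibSS binS; apply: leq_add.
      apply: leq_trans IH1 _; rewrite -[X in X <= _]bin_sub; last lia.
      by rewrite (_ : j.*2.+1 - j = j.+1) //; lia.
    exact: leq_trans IH0 (leq_bin2l _ (leqnSn _)).
  split=> //; rewrite binS doubleS in even_le *.
  rewrite FibSS; apply: leq_add => //.
  exact: leq_trans IH1 (leq_bin2l _ (leqnSn _)).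
have [even_n odd_n] := main n./2.
by rewrite -{1 2}[n]odd_double_half; case: (odd n).
Qed.

Section Staircase.
Variables (glue : bool) (r : nat).

(** Column blocks of length r.+1: block j ends with the column of the B-vertex j
   and has room for all r vertices of A before it. *)
Definition columnB (j : nat) := j * r.+1 + r.

(** The number [nth 0 h i] of B-vertices before the A-vertex i is the height of
    a staircase; [0 :: h] shifts the index, so its entry i is the previous
    height.  With [glue], an A-vertex at which the height jumps moves back into
    the column of the last B-vertex before it: the staircase can then be read
    off from the shared columns, without comparing greater with smaller. *)
Definition columnA (h : seq nat) (i : nat) :=
  if glue && (nth 0 (0 :: h) i < nth 0 h i) then columnB (nth 0 h i).-1
  else nth 0 h i * r.+1 + i.

Lemma columnA_le h i : i < r -> columnA h i <= nth 0 h i * r.+1 + i.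
Proof.
rewrite /columnA /columnB => ir; case: ifP => // /andP[_].
by case: (nth 0 h i) => [|c]; rewrite ?ltn0 //= mulSn; lia.
Qed.

Lemma columnB_ltn j j' : (columnB j < columnB j') = (j < j').
Proof. by rewrite /columnB ltn_add2r ltn_pmul2r. Qed.

Lemma columnA_ltn h i i' :
  sorted leq h -> size h = r -> i < i' < r -> columnA h i < columnA h i'.
Proof.
move=> h_sorted h_size /andP[ii' i'r].
have h_mono a b : a <= b < r -> nth 0 h a <= nth 0 h b.
  move=> /andP[ab br]; apply: (sorted_leq_nth leq_trans leqnn 0 h_sorted) => //.
    by rewrite inE h_size; apply: leq_ltn_trans br.
  by rewrite inE h_size.
apply: leq_ltn_trans (columnA_le _ (ltn_trans ii' i'r)) _.
rewrite [X in _ < X]/columnA; case: ifP => [/andP[_]|_]; last first.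
  have := h_mono i i'; rewrite (ltnW ii') i'r => /(_ isT) hii'.
  by rewrite -addnS leq_add // leq_mul2r hii' orbT.
case: i' ii' i'r => // i' ii' i'r /=.
have := h_mono i i'; rewrite -ltnS ii' ltnW // => /(_ isT) hii' h_step.
rewrite /columnB -addnS leq_add //; last by lia.
by rewrite leq_mul2r; apply/orP; right; lia.
Qed.

(** At the first index where two staircases differ, the higher one, u, jumps
    there, as the heights before agree with those of the lower one, h.  So in u
    the A-vertex i comes right after the last B-vertex below it, or is glued
    to it, while in h it still precedes that B-vertex. *)
Lemma columnA_split h u i :
  i < r -> (forall j, j < i -> nth 0 h j = nth 0 u j) ->
  sorted leq h -> size h = r -> nth 0 h i < nth 0 u i ->
  columnA h i < columnB (nth 0 u i).-1 /\
  if glue then columnA u i = columnB (nth 0 u i).-1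
  else columnB (nth 0 u i).-1 < columnA u i.
Proof.
move=> ir prefix h_sorted h_size hu.
have pred_hi : nth 0 (0 :: h) i <= nth 0 h i.
  case: i ir {prefix hu} => [|i] ir //=.
  by apply: (sortedP 0 h_sorted); rewrite h_size.
split.
  apply: leq_ltn_trans (columnA_le _ ir) _.
  rewrite /columnB -addnS leq_add // leq_mul2r; apply/orP; right; lia.
have -> : columnA u i = if glue then columnB (nth 0 u i).-1
    else nth 0 u i * r.+1 + i.
  rewrite /columnA; case: glue => //=.
  rewrite (_ : nth 0 (0 :: u) i = nth 0 (0 :: h) i) ?(leq_ltn_trans pred_hi hu) //.
  by case: i {ir hu pred_hi} prefix => [|i] prefix //=; rewrite prefix.
case: glue => //; rewrite /columnB.
by case: (nth 0 u i) hu => // c _ /=; rewrite mulSn; lia.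
Qed.

End Staircase.

(** If a smaller column of A is not joined to B as a greater one is, unglued
    staircases are told apart; otherwise glued ones are, as soon as sharing
    a column makes a difference. *)
Lemma Fib_le_profile_staircase (glue : bool) l k p n :
  3 <= l <= 6 ->
  pair_type l k p (Some (0, false)) (Some (1, true)) !=
    (if glue then pair_type l k p (Some (0, false)) (Some (0, true))
     else pair_type l k p (Some (1, false)) (Some (0, true))) ->
  Fib n <= profile (calG l k p) n.
Proof.
move=> l36 type_split; apply: leq_trans (Fib_le_central_binomial n) _.
pose r := n./2; pose s := n - r.
have -> : n = r + s by rewrite /s /r; lia.
rewrite (_ : (r + s)./2 = r) -?card_sorted_tuples; last by rewrite /s /r; lia.
pose heights (t : r.-tuple 'I_s.+1) := map val t.
pose x (t : r.-tuple 'I_s.+1) (a : 'I_r + 'I_s) : point :=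
  match a with
  | inl i => Some (columnA glue r (heights t) i, false)
  | inr j => Some (columnB r j, true)
  end.
have heights_size t : size (heights t) = r by rewrite size_map size_tuple.
have A_leq (t : r.-tuple 'I_s.+1) (i i' : 'I_r) : sorted leq (heights t) ->
    (columnA glue r (heights t) i <= columnA glue r (heights t) i') = (i <= i').
  move=> t_sorted; case: (ltngtP i i') => [ii'|i'i|/val_inj ->].
  - by apply: ltnW; apply: columnA_ltn; rewrite ?ii' /=.
  - by apply/negbTE; rewrite -ltnNge; apply: columnA_ltn; rewrite ?i'i /=.
  - exact: leqnn.
have B_leq (j j' : 'I_s) : (columnB r j <= columnB r j') = (j <= j').
  by rewrite leqNgt columnB_ltn -leqNgt.
rewrite cardE -[X in profile _ X](_ : #|{: 'I_r + 'I_s}| = _); last first.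
  by rewrite card_sum !card_ord.
apply: (@size_le_profile_calG _ _ _ _ _ _ x).
- exact: enum_uniq.
- by move=> t _ [].
- move=> t; rewrite mem_enum inE => t_sorted [i|j] [i'|j'] //= [E].
    congr inl; apply/val_inj/eqP.
    by rewrite eqn_leq -(A_leq t i i') // -(A_leq t i' i) // E leqnn.
  congr inr; apply/val_inj/eqP.
  by rewrite eqn_leq -(B_leq j j') -(B_leq j' j) E leqnn.
- move=> t u; rewrite !mem_enum !inE => t_sorted u_sorted a b.
  have lP : l = 3 \/ l = 4 \/ l = 5 \/ l = 6 by lia.
  by case: lP => [->|[->|[->|->]]]; case: a b => [i|j] [i'|j'] //=; rewrite !A_leq.
- move=> t u; rewrite !mem_enum !inE => t_sorted u_sorted tu.
  have ex_i : exists i, nth 0 (heights t) i != nth 0 (heights u) i.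
    apply: contrapT => no_i; case/eqP: tu; apply/val_inj/(inj_map val_inj).
    apply: (@eq_from_nth _ 0) => [|i _]; first by rewrite !heights_size.
    by apply/eqP/negPn/negP => tui; apply: no_i; exists i.
  case: (ex_minnP ex_i) => i tui i_min {ex_i}.
  have ir : i < r.
    by rewrite ltnNge; apply: contra tui => ri; rewrite !nth_default ?heights_size.
  have prefix j : j < i -> nth 0 (heights t) j = nth 0 (heights u) j.
    by move=> ji; apply/eqP/negPn/negP => /i_min; rewrite leqNgt ji.
  have first_split (v w : r.-tuple 'I_s.+1) :
      (forall j, j < i -> nth 0 (heights v) j = nth 0 (heights w) j) ->
      sorted leq (heights v) -> nth 0 (heights v) i < nth 0 (heights w) i ->
      exists a b, pair_type l k p (x v a) (x v b) != pair_type l k p (x w a) (x w b).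
    move=> vw v_sorted vwi.
    have [v_lt w_col] := columnA_split glue ir vw v_sorted (heights_size v) vwi.
    set c := nth 0 (heights w) i in vwi v_lt w_col.
    have c_lt : c.-1 < s.
      have : c <= s.
        rewrite /c (nth_map ord0) ?size_tuple //; exact: leq_ord.
      lia.
    exists (inl (Ordinal ir)), (inr (Ordinal c_lt)) => /=.
    rewrite (@pair_type_columns _ _ _ (columnA glue r (heights v) i) _ 0 1); try lia.
    apply: contra_neq type_split => ->; case: (glue) w_col => wi.
      by apply: pair_type_columns; rewrite wi leqnn.
    by apply: pair_type_columns; lia.
  case: (ltngtP (nth 0 (heights t) i) (nth 0 (heights u) i)) tui => // tui _.
    exact: first_split.
  have [|a [b ab]] := first_split u t _ u_sorted tui.
    by move=> j /prefix.
  by exists a, b; rewrite eq_sym.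
Qed.

(** * The members one by one *)

Definition low_check (l k p : nat) :=
  [|| has_a l k p &&
      (pair_type l k p None (Some (1, false)) != pair_type l k p None (Some (1, true))),
      has (fun c =>
        (pair_type l k p (Some (0, c)) (Some (1, false)) !=
           pair_type l k p (Some (0, c)) (Some (1, true))) ||
        (pair_type l k p (Some (0, false)) (Some (1, c)) !=
           pair_type l k p (Some (0, true)) (Some (1, c)))) [:: false; true]
    | all (fun i => pair_type l k p (Some (0, false)) (Some (0, true)) !=
        pair_type l k p (Some (0, i)) (Some (1, false))) [:: false; true]].

Definition high_check (l k p : nat) :=
  has (fun glue : bool =>
    pair_type l k p (Some (0, false)) (Some (1, true)) !=
    (if glue then pair_type l k p (Some (0, false)) (Some (0, true))
     else pair_type l k p (Some (1, false)) (Some (0, true)))) [:: false; true].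

Definition check (l k p : nat) :=
  if l <= 2 then low_check l k p else high_check l k p.

Lemma check_all l k p :
  1 <= l <= 6 -> 1 <= p <= 10 -> 1 <= k <= max_k l p -> check l k p.
Proof.
move=> l16 p110 k1max.
have checked : all (fun l => all (fun p => all (fun k => check l k p)
    (iota 1 (max_k l p))) (iota 1 10)) (iota 1 6) by vm_compute.
have in_iota a b : 1 <= a <= b -> a \in iota 1 b by rewrite mem_iota; lia.
by have /allP/(_ _ (in_iota _ _ l16))/allP/(_ _ (in_iota _ _ p110))/allP
  /(_ _ (in_iota _ _ k1max)) := checked.
Qed.

Lemma Fib_le_profile_calG l k p n :
  1 <= l <= 6 -> 1 <= p <= 10 -> 1 <= k <= max_k l p -> 0 < n ->
  Fib n <= profile (calG l k p) n.
Proof.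
move=> l16 p110 k1max; case: n => // m _.
have := check_all l16 p110 k1max; rewrite /check; case: ifP => l2.
  have l12 : 1 <= l <= 2 by lia.
  case/or3P=> [/andP[has_aP a_split]|/hasP[c _ /orP[] c_split]|/allP glued].
  - by apply: (@Fib_le_profile_first _ _ _ _ None).
  - by apply: (@Fib_le_profile_first _ _ _ _ (Some (0, c))) => //; case: c c_split.
  - exact: Fib_le_profile_last c_split.
  - by apply: Fib_le_profile_glued => // i; apply: glued; case: i.
by case/hasP=> glue _; apply: Fib_le_profile_staircase; lia.
Qed.

Theorem proposition1p7 (G : ordered_digraph) (hG : frakA1 G) :
  (exists2 phi : nat -> nat, five_profiles phi &
     forall n : nat, 2 <= n -> profile G n = phi n) \/
  (exists2 phi : nat -> nat, five_profiles phi &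
     forall n : nat, 2 <= n -> phi n <= profile G n).
Proof.
right; exists Fib; first by right.
move=> n n2; have [l [k [p [l16 p110 k1max ->]]]] := hG.
by apply: Fib_le_profile_calG => //; lia.
Qed.
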